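(* Let $R>0$, let $B=B(0,R)\subset\mathbb{H}$, and let $f : B \to \mathbb{H}$ be a regular function. For all $x,y\in\mathbb{R}$ such that $x+y\mathbb{S}\subseteq B$ there exist $b,c\in\mathbb{H}$ such that $$f(x+yI)=b+Ic$$ for all $I\in\mathbb{S}$. Moreover, $c=0$ if and only if $f$ is constant on $x+y\mathbb{S}$.
   Context: $\mathbb{H}$ is the skew field of real quaternions, with the usual norm $|\cdot|$, and $B(0,R)=\{q\in\mathbb{H}:|q|<R\}$. Let $\mathbb{S}=\{q\in\mathbb{H}:q^2=-1\}$ be the 2-sphere of imaginary units and, for $I\in\mathbb{S}$, let $L_I=\mathbb{R}+I\mathbb{R}$. A real differentiable function $f:\Omega\to\mathbb{H}$ on a domain $\Omega\subseteq\mathbb{H}$ is called regular (Cullen-regular) if for every $I\in\mathbb{S}$ the restriction $f_I$ of $f$ to $\Omega\cap L_I$ satisfies $\frac12\left(\frac{\partial}{\partial x}+I\frac{\partial}{\partial y}\right)f_I(x+Iy)=0$ at every point $x+Iy$ of $\Omega\cap L_I$ ($x,y\in\mathbb{R}$). For $x,y\in\mathbb{R}$ write $x+y\mathbb{S}=\{x+yI:I\in\mathbb{S}\}$ (a 2-sphere if $y\ne0$, the singleton $\{x\}$ if $y=0$). *)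

(* Defs.v *)
From Stdlib Require Import Reals Lra.
From Coquelicot Require Import Coquelicot.
Open Scope R_scope.

(* (a, b, c, d) stands for a + b i + c j + d k.  The real normed space
   structure is Coquelicot's product structure, whose norm is Euclidean
   (see [Hnorm_norm]). *)
Definition H : Type := (R * R * R * R)%type.

Definition H_prod : NormedModule R_AbsRing :=
  prod_NormedModule R_AbsRing
    (prod_NormedModule R_AbsRing
       (prod_NormedModule R_AbsRing R_NormedModule R_NormedModule)
       R_NormedModule)
    R_NormedModule.

Canonical H_AbelianMonoid : AbelianMonoid :=
  AbelianMonoid.Pack H (AbelianMonoid.class H_prod) H.

Canonical H_AbelianGroup : AbelianGroup :=
  AbelianGroup.Pack H (AbelianGroup.class H_prod) H.

Canonical H_UniformSpace : UniformSpace :=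
  UniformSpace.Pack H (UniformSpace.class H_prod) H.

Canonical H_ModuleSpace : ModuleSpace R_Ring :=
  ModuleSpace.Pack R_Ring H (ModuleSpace.class R_Ring H_prod) H.

Canonical H_NormedModuleAux : NormedModuleAux R_AbsRing :=
  NormedModuleAux.Pack R_AbsRing H (NormedModuleAux.class R_AbsRing H_prod) H.

Canonical H_NormedModule : NormedModule R_AbsRing :=
  NormedModule.Pack R_AbsRing H (NormedModule.class R_AbsRing H_prod) H.

Definition RtoH (x : R) : H := (x, 0, 0, 0).

Definition Hone : H := RtoH 1.

Definition Hmult (p q : H) : H :=
  let '(a1, b1, c1, d1) := p in
  let '(a2, b2, c2, d2) := q in
  (a1 * a2 - b1 * b2 - c1 * c2 - d1 * d2,
   a1 * b2 + b1 * a2 + c1 * d2 - d1 * c2,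
   a1 * c2 - b1 * d2 + c1 * a2 + d1 * b2,
   a1 * d2 + b1 * c2 - c1 * b2 + d1 * a2).

Definition Hnorm (q : H) : R :=
  let '(a, b, c, d) := q in sqrt (a ^ 2 + b ^ 2 + c ^ 2 + d ^ 2).

Lemma Hnorm_norm (q : H) : Hnorm q = norm q.
Proof.
destruct q as [[[a b] c] d]; simpl.
unfold norm; simpl; unfold prod_norm, norm; simpl; unfold prod_norm, norm; simpl;
  unfold prod_norm, norm; simpl; unfold abs; simpl.
f_equal.
rewrite !Rmult_1_r.
repeat rewrite sqrt_sqrt;
  repeat rewrite <- Rabs_mult; try rewrite !Rabs_pos_eq; nra.
Qed.

Lemma Hmult_assoc (p q s : H) : Hmult p (Hmult q s) = Hmult (Hmult p q) s.
Proof.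
destruct p as [[[? ?] ?] ?], q as [[[? ?] ?] ?], s as [[[? ?] ?] ?]; simpl.
f_equal; [f_equal; [f_equal|]|]; ring.
Qed.

Lemma Hmult_1_r (q : H) : Hmult q Hone = q.
Proof.
destruct q as [[[? ?] ?] ?]; simpl.
f_equal; [f_equal; [f_equal|]|]; ring.
Qed.

Lemma Hmult_1_l (q : H) : Hmult Hone q = q.
Proof.
destruct q as [[[? ?] ?] ?]; simpl.
f_equal; [f_equal; [f_equal|]|]; ring.
Qed.

Lemma Hmult_plus_distr_r (p q s : H) :
  Hmult (plus p q) s = plus (Hmult p s) (Hmult q s).
Proof.
destruct p as [[[? ?] ?] ?], q as [[[? ?] ?] ?], s as [[[? ?] ?] ?].
apply injective_projections; [apply injective_projections;
  [apply injective_projections|]|]; cbn; unfold plus; cbn; ring.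
Qed.

Lemma Hmult_plus_distr_l (p q s : H) :
  Hmult p (plus q s) = plus (Hmult p q) (Hmult p s).
Proof.
destruct p as [[[? ?] ?] ?], q as [[[? ?] ?] ?], s as [[[? ?] ?] ?].
apply injective_projections; [apply injective_projections;
  [apply injective_projections|]|]; cbn; unfold plus; cbn; ring.
Qed.

Definition H_Ring_mixin : Ring.mixin_of H_AbelianGroup :=
  Ring.Mixin H_AbelianGroup Hmult Hone Hmult_assoc Hmult_1_r Hmult_1_l
    Hmult_plus_distr_r Hmult_plus_distr_l.

Canonical H_Ring : Ring :=
  Ring.Pack H (Ring.Class H (AbelianGroup.class H_AbelianGroup) H_Ring_mixin) H.

Declare Scope H_scope.
Delimit Scope H_scope with H.
Bind Scope H_scope with H.
Notation "p + q" := (@plus H_AbelianMonoid p q) : H_scope.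
Notation "- q" := (@opp H_AbelianGroup q) : H_scope.
Notation "p * q" := (@mult H_Ring p q) : H_scope.
Notation "0" := (@zero H_AbelianMonoid) : H_scope.

Definition Hball (r : R) (q : H) : Prop := Hnorm q < r.

Definition imag_unit (I : H) : Prop := (I * I = - Hone)%H.

Definition slice (x y : R) (I : H) : H := (RtoH x + RtoH y * I)%H.

(* x + y S *)
Definition sphere (x y : R) (q : H) : Prop :=
  exists I, imag_unit I /\ q = slice x y I.

(* Used for open [Omega] only: [f] is total, and neither condition at a point
   of an open [Omega] depends on its values outside [Omega].  [fx] and [fy]
   are the partial derivatives of (x, y) |-> f (x + I y), unique if they
   exist; the imaginary unit multiplies on the left. *)
Definition regular (Omega : H -> Prop) (f : H -> H) : Prop :=
  (forall q : H, Omega q ->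
     ex_filterdiff f (locally q)) /\
  (forall I : H, imag_unit I -> forall x y : R, Omega (slice x y I) ->
     exists fx fy : H,
       is_derive (fun t : R => f (slice t y I)) x fx /\
       is_derive (fun t : R => f (slice x t I)) y fy /\
       (RtoH (1 / 2) * (fx + I * fy) = 0)%H).

Definition constant_on (A : H -> Prop) (f : H -> H) : Prop :=
  exists k : H, forall q : H, A q -> f q = k.

(* Main.v *)
Require Import Defs.
From Stdlib Require Import Reals Lra Classical ClassicalEpsilon.
From Coquelicot Require Import Coquelicot.
Open Scope R_scope.

(** Fix two imaginary units I and J.  The right-hand side of
      f(x + yI) = (1 - IJ)/2 * f(x + yJ) + (1 + IJ)/2 * f(x - yJ)
    satisfies, as a function of (x, y), the same Cauchy-Riemann equation for
    left multiplication by I as the left-hand side, because each weight e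
    intertwines the units: e J' = I e, with J' = J or J' = - J.  The two weights
    add up to 1, so both sides agree on the real axis; by the identity principle
    they agree on the disc ([representation_formula]).  Collecting the terms
    with and without I gives b = (f(x + yJ) + f(x - yJ))/2 and
    c = J (f(x - yJ) - f(x + yJ))/2, and c = 0 says exactly that f takes the
    same value at x + yJ and x - yJ.

    The analytic content is the identity principle: a holomorphic F on a disc
    that vanishes on the real diameter is zero ([identity_theorem_upper]).  Here
    F is merely differentiable at each point, and its derivative is not assumed
    continuous, so the integral theorem has to be proved as Goursat did, by
    bisection ([Goursat_rectangle]).  To see that F vanishes at rho e^(i alpha), pass to
    G(s, t) = F(rho e^(s + it)) on the rectangle -S <= s <= 0, 0 <= t <= pi, whose
    horizontal sides are mapped to the real axis, so that G = 0 there.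
    Multiply G by W^n, where W is a polynomial in s + it that on the side s = 0
    is real and nonnegative with a strict maximum 1 at t = alpha, and on the
    side s = -S has modulus at most 7/10.  Goursat's theorem for G W^n makes the
    integral over the first side equal to the integral over the second, hence
    O((7/10)^n); but the powers of W on the first side concentrate at alpha, so
    this forces G(0, alpha) = 0 ([peak_kernel]). *)

(** * Goursat for closed differential forms on a rectangle *)

(** Only rectangles with sides in the fixed ratio L : M occur, so that a single
    scale t controls both area and diameter. *)
Definition subrectangle (a c L M x y t : R) : Prop :=
  (a <= x /\ x + t * L <= a + L) /\ (c <= y /\ y + t * M <= c + M).

(** If P failed for the whole rectangle, it would fail for one of its quarters,
    and so on; the nested failing rectangles shrink to a point, where the local
    hypothesis is contradicted. *)
Lemma rectangle_bisection (P : R -> R -> R -> Prop) (a c L M : R) :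
  0 <= L -> 0 <= M ->
  (forall x y t, 0 < t -> subrectangle a c L M x y t ->
     P x y (t / 2) -> P (x + t / 2 * L) y (t / 2) ->
     P x (y + t / 2 * M) (t / 2) -> P (x + t / 2 * L) (y + t / 2 * M) (t / 2) ->
     P x y t) ->
  (forall x y, a <= x <= a + L -> c <= y <= c + M ->
     exists delta, 0 < delta /\
       forall x' y' t, 0 < t < delta -> subrectangle a c L M x' y' t ->
         x' <= x <= x' + t * L -> y' <= y <= y' + t * M -> P x' y' t) ->
  P a c 1.
Proof.
intros HL HM Hmerge Hloc.
apply NNPP; intro Hnot.
set (T := fun n => (/ 2) ^ n).
assert (HT : forall n, 0 < T n) by (intro n; apply pow_lt; lra).
assert (HTS : forall n, T (S n) = T n / 2) by (intro n; unfold T; simpl; lra).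
set (bad := fun n (z : R * R) =>
  subrectangle a c L M (fst z) (snd z) (T n) /\ ~ P (fst z) (snd z) (T n)).
assert (step : forall n (z : R * R), bad n z -> exists z' : R * R, bad (S n) z' /\
  (fst z <= fst z' /\ fst z' + T (S n) * L <= fst z + T n * L) /\
  (snd z <= snd z' /\ snd z' + T (S n) * M <= snd z + T n * M)).
{ intros n [x y] [[[H1 H2] [H3 H4]] HP]; unfold bad, subrectangle; simpl in *.
  rewrite HTS. specialize (HT n). revert HT H2 H4 HP; generalize (T n) as t; intros t HT H2 H4 HP.
  assert (0 <= t / 2 * L) by (apply Rmult_le_pos; lra).
  assert (0 <= t / 2 * M) by (apply Rmult_le_pos; lra).
  replace (t * L) with (t / 2 * L + t / 2 * L) in * by lra.
  replace (t * M) with (t / 2 * M + t / 2 * M) in * by lra.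
  destruct (classic (P x y (t / 2))) as [P1|P1];
    [|exists (x, y); simpl; repeat split; try assumption; lra].
  destruct (classic (P (x + t / 2 * L) y (t / 2))) as [P2|P2];
    [|exists (x + t / 2 * L, y); simpl; repeat split; try assumption; lra].
  destruct (classic (P x (y + t / 2 * M) (t / 2))) as [P3|P3];
    [|exists (x, y + t / 2 * M); simpl; repeat split; try assumption; lra].
  destruct (classic (P (x + t / 2 * L) (y + t / 2 * M) (t / 2))) as [P4|P4];
    [|exists (x + t / 2 * L, y + t / 2 * M); simpl; repeat split; try assumption; lra].
  elim HP. apply Hmerge; try assumption.
  unfold subrectangle; repeat split; lra. }
set (next := fun n (z : R * R) => epsilon (inhabits z) (fun z' => bad (S n) z' /\
  (fst z <= fst z' /\ fst z' + T (S n) * L <= fst z + T n * L) /\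
  (snd z <= snd z' /\ snd z' + T (S n) * M <= snd z + T n * M))).
set (Z := fix Z n := match n with O => (a, c) | S n => next n (Z n) end).
assert (HZ : forall n, bad n (Z n)).
{ induction n as [|n IH].
  - unfold bad, subrectangle, T; simpl. repeat split; try lra. exact Hnot.
  - exact (proj1 (epsilon_spec (inhabits (Z n)) _ (step n _ IH))). }
assert (HZS : forall n,
  (fst (Z n) <= fst (Z (S n)) /\ fst (Z (S n)) + T (S n) * L <= fst (Z n) + T n * L) /\
  (snd (Z n) <= snd (Z (S n)) /\ snd (Z (S n)) + T (S n) * M <= snd (Z n) + T n * M)).
{ intro n. exact (proj2 (epsilon_spec (inhabits (Z n)) _ (step n _ (HZ n)))). }
assert (nested : forall (u : nat -> R) K, 0 <= K ->
  (forall n, u n <= u (S n) /\ u (S n) + T (S n) * K <= u n + T n * K) ->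
  exists l, forall n, u n <= l <= u n + T n * K).
{ intros u K HK Hu.
  assert (inc : forall n m, u n <= u (n + m)%nat).
  { intros n m; induction m as [|m IH]; [rewrite Nat.add_0_r; lra|].
    rewrite Nat.add_succ_r. destruct (Hu (n + m)%nat); lra. }
  assert (dec : forall n m, u (n + m)%nat + T (n + m)%nat * K <= u n + T n * K).
  { intros n m; induction m as [|m IH]; [rewrite Nat.add_0_r; lra|].
    rewrite Nat.add_succ_r. destruct (Hu (n + m)%nat); lra. }
  assert (pos : forall n, 0 <= T n * K)
    by (intro n; apply Rmult_le_pos; [apply Rlt_le, HT|exact HK]).
  assert (cross : forall n m, u m <= u n + T n * K).
  { intros n m. apply Rle_trans with (u (n + m)%nat).
    - rewrite Nat.add_comm. apply inc.
    - generalize (dec n m) (pos (n + m)%nat); lra. }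
  destruct (completeness (fun r => exists n, r = u n)) as [l [Hub Hlub]].
  - exists (u O + T O * K). intros r [n ->]. apply cross.
  - exists (u O), O; reflexivity.
  - exists l; intro n; split.
    + apply Hub; exists n; reflexivity.
    + apply Hlub; intros r [m ->]; apply cross. }
destruct (nested (fun n => fst (Z n)) L HL (fun n => proj1 (HZS n))) as [x Hx].
destruct (nested (fun n => snd (Z n)) M HM (fun n => proj2 (HZS n))) as [y Hy].
generalize (Hx O) (Hy O); unfold T; simpl; rewrite !Rmult_1_l; intros Hx0 Hy0.
destruct (Hloc x y Hx0 Hy0) as [delta [Hd Hdelta]].
destruct (pow_lt_1_zero (/ 2)) with (y := delta) as [N HN];
  [rewrite Rabs_pos_eq; lra|exact Hd|].
specialize (HN N (Nat.le_refl N)).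
rewrite Rabs_pos_eq in HN by (apply Rlt_le, HT).
apply (proj2 (HZ N)). apply Hdelta.
- split; [apply HT|exact HN].
- apply HZ.
- apply Hx.
- apply Hy.
Qed.

Lemma continuity_2d_pt_left (f : R -> R -> R) (x y : R) :
  continuity_2d_pt f x y -> continuous (fun u => f u y) x.
Proof.
intro Hf. apply filterlim_locally; intro eps.
destruct (Hf eps) as [d Hd]. exists d; intros u Hu.
apply (Hd u y); [exact Hu|rewrite Rminus_diag, Rabs_R0; apply cond_pos].
Qed.

Lemma continuity_2d_pt_right (f : R -> R -> R) (x y : R) :
  continuity_2d_pt f x y -> continuous (fun v => f x v) y.
Proof.
intro Hf. apply filterlim_locally; intro eps.
destruct (Hf eps) as [d Hd]. exists d; intros u Hu.
apply (Hd x u); [rewrite Rminus_diag, Rabs_R0; apply cond_pos|exact Hu].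
Qed.

(** Closedness of P dx + Q dy: the number m is both dP/dy and dQ/dx. *)
Definition closed_form_at (P Q : R -> R -> R) (x y : R) : Prop :=
  exists p m q, differentiable_pt_lim P x y p m /\ differentiable_pt_lim Q x y m q.

(** The integral of P dx + Q dy along the boundary, counterclockwise, with
    opposite sides grouped: the linear parts of P and Q then contribute
    constants to the integrands. *)
Definition rectangle_integral (P Q : R -> R -> R) (a b c d : R) : R :=
  RInt (fun x => P x c - P x d) a b + RInt (fun y => Q b y - Q a y) c d.

Lemma RInt_minus_const_bound (f : R -> R) (a b k e : R) :
  a <= b -> ex_RInt f a b ->
  (forall x, a <= x <= b -> Rabs (f x - k) <= e) ->
  Rabs (RInt f a b - (b - a) * k) <= (b - a) * e.
Proof.
intros Hab Hf Hk.
replace (RInt f a b - (b - a) * k) with (RInt (fun x => f x - k) a b).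
- apply abs_RInt_le_const; [exact Hab| |exact Hk].
  apply (ex_RInt_minus (V := R_NormedModule)); [exact Hf|apply ex_RInt_const].
- transitivity (RInt f a b - RInt (fun _ => k) a b).
  + apply (RInt_minus (V := R_CompleteNormedModule)); [exact Hf|apply ex_RInt_const].
  + rewrite RInt_const. unfold scal; simpl; unfold mult; simpl. reflexivity.
Qed.

(** Near a point, P dx + Q dy is a closed form with affine coefficients, whose
    boundary integral is zero, up to an error o(t) on rectangles of scale t.
    Hence the integral over such a rectangle is at most eps t^2, and these bounds
    add up under subdivision. *)
Lemma Goursat_rectangle (P Q : R -> R -> R) (a b c d : R) :
  a <= b -> c <= d ->
  (forall x y, a <= x <= b -> c <= y <= d -> closed_form_at P Q x y) ->
  rectangle_integral P Q a b c d = 0.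
Proof.
intros Hab Hcd Hclosed.
assert (contP : forall x y, a <= x <= b -> c <= y <= d -> continuity_2d_pt P x y).
{ intros x y Hx Hy. destruct (Hclosed x y Hx Hy) as [p [m [q [H _]]]].
  apply differentiable_continuity_pt. exists p, m; exact H. }
assert (contQ : forall x y, a <= x <= b -> c <= y <= d -> continuity_2d_pt Q x y).
{ intros x y Hx Hy. destruct (Hclosed x y Hx Hy) as [p [m [q [_ H]]]].
  apply differentiable_continuity_pt. exists m, q; exact H. }
assert (intP : forall u v y y', a <= u <= v -> v <= b -> c <= y <= d -> c <= y' <= d ->
  ex_RInt (fun x => P x y - P x y') u v).
{ intros u v y y' Hu Hv Hy Hy'. apply (ex_RInt_continuous (V := R_CompleteNormedModule)).
  intros z Hz. rewrite Rmin_left, Rmax_right in Hz by lra.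
  apply (continuous_minus (V := R_NormedModule)); apply (continuity_2d_pt_left P), contP; lra. }
assert (intQ : forall u v x x', c <= u <= v -> v <= d -> a <= x <= b -> a <= x' <= b ->
  ex_RInt (fun y => Q x y - Q x' y) u v).
{ intros u v x x' Hu Hv Hx Hx'. apply (ex_RInt_continuous (V := R_CompleteNormedModule)).
  intros z Hz. rewrite Rmin_left, Rmax_right in Hz by lra.
  apply (continuous_minus (V := R_NormedModule)); apply (continuity_2d_pt_right Q), contQ; lra. }
assert (additive_x : forall u v w y y', a <= u <= v -> v <= w <= b -> c <= y <= y' -> y' <= d ->
  rectangle_integral P Q u w y y' =
  rectangle_integral P Q u v y y' + rectangle_integral P Q v w y y').
{ intros u v w y y' Hu Hv Hy Hy'; unfold rectangle_integral.
  rewrite <- (RInt_Chasles (fun x => P x y - P x y') u v w) by (apply intP; lra).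
  rewrite (RInt_ext (fun z => Q w z - Q u z)
     (fun z => plus (Q w z - Q v z) (Q v z - Q u z)))
     by (intros; unfold plus; simpl; ring).
  rewrite (RInt_plus (V := R_CompleteNormedModule)) by (apply intQ; lra).
  unfold plus; simpl; ring. }
assert (additive_y : forall u v w x x', c <= u <= v -> v <= w <= d -> a <= x <= x' -> x' <= b ->
  rectangle_integral P Q x x' u w =
  rectangle_integral P Q x x' u v + rectangle_integral P Q x x' v w).
{ intros u v w x x' Hu Hv Hx Hx'; unfold rectangle_integral.
  rewrite <- (RInt_Chasles (fun y => Q x' y - Q x y) u v w) by (apply intQ; lra).
  rewrite (RInt_ext (fun z => P z u - P z w)
     (fun z => plus (P z u - P z v) (P z v - P z w)))
     by (intros; unfold plus; simpl; ring).
  rewrite (RInt_plus (V := R_CompleteNormedModule)) by (apply intP; lra).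
  unfold plus; simpl; ring. }
set (L := b - a); set (M := d - c).
assert (HL : 0 <= L) by (unfold L; lra).
assert (HM : 0 <= M) by (unfold M; lra).
assert (small : forall eps, 0 < eps -> Rabs (rectangle_integral P Q a b c d) <= eps).
{ intros eps Heps.
  assert (Hbis : Rabs (rectangle_integral P Q a (a + 1 * L) c (c + 1 * M)) <= eps * 1 ^ 2).
  { apply (rectangle_bisection (fun x y t =>
      Rabs (rectangle_integral P Q x (x + t * L) y (y + t * M)) <= eps * t ^ 2) a c L M HL HM).
    (* The bounds for four quarters of scale t/2 add up: 4 eps (t/2)^2 = eps t^2. *)
    - intros x y t Ht [[Hx1 Hx2] [Hy1 Hy2]].
      assert (HtL : 0 <= t / 2 * L) by (apply Rmult_le_pos; lra).
      assert (HtM : 0 <= t / 2 * M) by (apply Rmult_le_pos; lra).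
      replace (t * L) with (t / 2 * L + t / 2 * L) in * by lra.
      replace (t * M) with (t / 2 * M + t / 2 * M) in * by lra.
      rewrite <- !Rplus_assoc in *.
      set (x1 := x + t / 2 * L) in *; set (y1 := y + t / 2 * M) in *.
      set (x2 := x1 + t / 2 * L) in *; set (y2 := y1 + t / 2 * M) in *.
      assert (x <= x1 <= x2) by (unfold x2, x1; lra).
      assert (y <= y1 <= y2) by (unfold y2, y1; lra).
      assert (x2 <= b) by (unfold L in Hx2; lra).
      assert (y2 <= d) by (unfold M in Hy2; lra).
      intros B1 B2 B3 B4.
      rewrite (additive_x x x1 x2 y y2) by lra.
      rewrite (additive_y y y1 y2 x x1), (additive_y y y1 y2 x1 x2) by lra.
      apply Rabs_le_between in B1; apply Rabs_le_between in B2;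
      apply Rabs_le_between in B3; apply Rabs_le_between in B4.
      apply Rabs_le_between. lra.
    - intros x y Hx Hy.
      assert (Hx' : a <= x <= b) by (unfold L in Hx; lra).
      assert (Hy' : c <= y <= d) by (unfold M in Hy; lra).
      destruct (Hclosed x y Hx' Hy') as [p [m [q [DP DQ]]]].
      set (K := L + M).
      assert (HK : 0 <= K) by (unfold K; lra).
      assert (He : 0 < eps / (2 * K * K + 1)) by (apply Rdiv_lt_0_compat; nra).
      destruct (DP (mkposreal _ He)) as [d1 H1].
      destruct (DQ (mkposreal _ He)) as [d2 H2].
      simpl in H1, H2.
      set (e := eps / (2 * K * K + 1)) in *.
      assert (Hbound : 2 * K * K * e <= eps).
      { assert (e * (2 * K * K + 1) = eps) by (unfold e; field; nra). nra. }
      clearbody e.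
      assert (Hd : 0 < Rmin d1 d2) by (apply Rmin_glb_lt; apply cond_pos).
      exists (Rmin d1 d2 / (K + 1)). split; [apply Rdiv_lt_0_compat; lra|].
      intros u v t [Ht Htd] [[Hu1 Hu2] [Hv1 Hv2]] Hux Hvy.
      assert (HtK : t * K < Rmin d1 d2).
      { apply Rle_lt_trans with (t * (K + 1)); [nra|].
        apply Rlt_div_r in Htd; lra. }
      assert (HtL : 0 <= t * L <= t * K) by (unfold K; split; nra).
      assert (HtM : 0 <= t * M <= t * K) by (unfold K; split; nra).
      assert (near : forall x' y', u <= x' <= u + t * L -> v <= y' <= v + t * M ->
        Rabs (P x' y' - P x y - (p * (x' - x) + m * (y' - y))) <= e * (t * K) /\
        Rabs (Q x' y' - Q x y - (m * (x' - x) + q * (y' - y))) <= e * (t * K)).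
      { intros x' y' Hx'' Hy''.
        assert (Rabs (x' - x) <= t * K) by (apply Rabs_le_between; lra).
        assert (Rabs (y' - y) <= t * K) by (apply Rabs_le_between; lra).
        generalize (Rmin_l d1 d2) (Rmin_r d1 d2); intros.
        split; (eapply Rle_trans; [first [apply H1|apply H2]; lra|]);
          apply Rmult_le_compat_l; try lra; apply Rmax_lub; assumption. }
      (* The leading terms of E1 and E2 are - m t^2 L M and m t^2 L M: they cancel
         because dP/dy and dQ/dx have the same value m. *)
      assert (E1 : Rabs (RInt (fun x' => P x' v - P x' (v + t * M)) u (u + t * L)
                 - (u + t * L - u) * (- (m * (t * M)))) <= (u + t * L - u) * (2 * (e * (t * K)))).
      { apply RInt_minus_const_bound; [lra|apply intP; unfold L, M in *; lra|].
        intros x' Hx''.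
        destruct (near x' v) as [B1 _]; [lra|lra|].
        destruct (near x' (v + t * M)) as [B2 _]; [lra|lra|].
        apply Rabs_le_between in B1; apply Rabs_le_between in B2.
        apply Rabs_le_between; lra. }
      assert (E2 : Rabs (RInt (fun y' => Q (u + t * L) y' - Q u y') v (v + t * M)
                 - (v + t * M - v) * (m * (t * L))) <= (v + t * M - v) * (2 * (e * (t * K)))).
      { apply RInt_minus_const_bound; [lra|apply intQ; unfold L, M in *; lra|].
        intros y' Hy''.
        destruct (near (u + t * L) y') as [_ B1]; [lra|lra|].
        destruct (near u y') as [_ B2]; [lra|lra|].
        apply Rabs_le_between in B1; apply Rabs_le_between in B2.
        apply Rabs_le_between; lra. }
      unfold rectangle_integral.
      apply Rle_trans with (2 * K * K * e * t ^ 2); [|apply Rmult_le_compat_r; [nra|lra]].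
      replace (2 * K * K * e * t ^ 2) with
        ((u + t * L - u) * (2 * (e * (t * K))) + (v + t * M - v) * (2 * (e * (t * K))))
        by (unfold K; ring).
      apply Rabs_le_between in E1; apply Rabs_le_between in E2.
      apply Rabs_le_between. lra. }
  rewrite !Rmult_1_l, pow1, Rmult_1_r in Hbis.
  replace (a + L) with b in Hbis by (unfold L; ring).
  replace (c + M) with d in Hbis by (unfold M; ring).
  exact Hbis. }
destruct (Req_dec (rectangle_integral P Q a b c d) 0) as [E|E]; [exact E|].
apply Rabs_pos_lt in E.
specialize (small (Rabs (rectangle_integral P Q a b c d) / 2) ltac:(lra)). lra.
Qed.

(** * Functions satisfying the Cauchy-Riemann equations *)

(** The differential, a real 2 by 2 matrix, is multiplication by D. *)
Definition is_complex_derivative (F : R -> R -> C) (x y : R) (D : C) : Prop :=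
  differentiable_pt_lim (fun u v => Re (F u v)) x y (Re D) (- Im D) /\
  differentiable_pt_lim (fun u v => Im (F u v)) x y (Im D) (Re D).

Definition holomorphic_at (F : R -> R -> C) (x y : R) : Prop :=
  exists D, is_complex_derivative F x y D.

Lemma differentiable_pt_lim_eq (f : R -> R -> R) (x y p m p' m' : R) :
  differentiable_pt_lim f x y p m -> p = p' -> m = m' ->
  differentiable_pt_lim f x y p' m'.
Proof. intros Hf <- <-; exact Hf. Qed.

Lemma differentiable_pt_lim_affine (p m k x y : R) :
  differentiable_pt_lim (fun u v => p * u + m * v + k) x y p m.
Proof.
intro eps; exists (mkposreal 1 Rlt_0_1); intros u v _ _.
replace (_ - _ - _) with 0 by ring. rewrite Rabs_R0.
apply Rmult_le_pos; [apply Rlt_le, cond_pos|].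
apply Rle_trans with (2 := Rmax_l _ _), Rabs_pos.
Qed.

Lemma differentiable_pt_lim_product (x y : R) :
  differentiable_pt_lim (fun u v => u * v) x y y x.
Proof.
intro eps; exists eps; intros u v Hu _.
replace (_ - _ - _) with ((u - x) * (v - y)) by ring.
rewrite Rabs_mult.
apply Rmult_le_compat; try apply Rabs_pos; [lra|apply Rmax_r].
Qed.

Lemma differentiable_pt_lim_plus (f g : R -> R -> R) (x y p m p' m' : R) :
  differentiable_pt_lim f x y p m -> differentiable_pt_lim g x y p' m' ->
  differentiable_pt_lim (fun u v => f u v + g u v) x y (p + p') (m + m').
Proof.
intros Hf Hg.
replace (p + p') with (1 * p + 1 * p') by ring.
replace (m + m') with (1 * m + 1 * m') by ring.
apply (differentiable_pt_lim_comp (fun u v => u + v)); [|exact Hf|exact Hg].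
apply differentiable_pt_lim_ext with (fun u v => 1 * u + 1 * v + 0).
- exists (mkposreal 1 Rlt_0_1); intros; ring.
- apply differentiable_pt_lim_affine.
Qed.

Lemma differentiable_pt_lim_mult (f g : R -> R -> R) (x y p m p' m' : R) :
  differentiable_pt_lim f x y p m -> differentiable_pt_lim g x y p' m' ->
  differentiable_pt_lim (fun u v => f u v * g u v) x y
    (g x y * p + f x y * p') (g x y * m + f x y * m').
Proof.
intros Hf Hg.
apply (differentiable_pt_lim_comp (fun u v => u * v)); [|exact Hf|exact Hg].
apply differentiable_pt_lim_product.
Qed.

Lemma differentiable_pt_lim_opp (f : R -> R -> R) (x y p m : R) :
  differentiable_pt_lim f x y p m ->
  differentiable_pt_lim (fun u v => - f u v) x y (- p) (- m).
Proof.
intros Hf.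
apply differentiable_pt_lim_ext with (fun u v => (0 * u + 0 * v + -1) * f u v).
- exists (mkposreal 1 Rlt_0_1); intros; ring.
- replace (- p) with (f x y * 0 + (0 * x + 0 * y + -1) * p) by ring.
  replace (- m) with (f x y * 0 + (0 * x + 0 * y + -1) * m) by ring.
  apply (differentiable_pt_lim_mult (fun u v => 0 * u + 0 * v + -1));
    [apply differentiable_pt_lim_affine|exact Hf].
Qed.

Lemma holomorphic_const (k : C) (x y : R) : holomorphic_at (fun _ _ => k) x y.
Proof.
exists 0%C; split; simpl; rewrite ?Ropp_0;
  (eapply differentiable_pt_lim_ext; [|apply (differentiable_pt_lim_affine 0 0)]);
  exists (mkposreal 1 Rlt_0_1); intros; ring_simplify; reflexivity.
Qed.

Lemma holomorphic_id (x y : R) : holomorphic_at (fun u v => (u, v)) x y.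
Proof.
exists 1%C; split; simpl; rewrite ?Ropp_0;
  (eapply differentiable_pt_lim_ext; [|apply (differentiable_pt_lim_affine _ _ 0)]);
  exists (mkposreal 1 Rlt_0_1); intros; simpl; ring.
Qed.

Lemma holomorphic_plus (F G : R -> R -> C) (x y : R) :
  holomorphic_at F x y -> holomorphic_at G x y ->
  holomorphic_at (fun u v => F u v + G u v)%C x y.
Proof.
intros [D [D1 D2]] [E [E1 E2]]; exists (D + E)%C; split; simpl.
- rewrite Ropp_plus_distr. exact (differentiable_pt_lim_plus _ _ _ _ _ _ _ _ D1 E1).
- exact (differentiable_pt_lim_plus _ _ _ _ _ _ _ _ D2 E2).
Qed.

Lemma holomorphic_mult (F G : R -> R -> C) (x y : R) :
  holomorphic_at F x y -> holomorphic_at G x y ->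
  holomorphic_at (fun u v => F u v * G u v)%C x y.
Proof.
intros [D [D1 D2]] [E [E1 E2]]; exists (D * G x y + F x y * E)%C; split.
- refine (differentiable_pt_lim_eq _ _ _ _ _ _ _
    (differentiable_pt_lim_plus _ _ _ _ _ _ _ _
    (differentiable_pt_lim_mult _ _ _ _ _ _ _ _ D1 E1)
    (differentiable_pt_lim_opp _ _ _ _ _ (differentiable_pt_lim_mult _ _ _ _ _ _ _ _ D2 E2))) _ _);
    unfold Re, Im; simpl; ring.
- refine (differentiable_pt_lim_eq _ _ _ _ _ _ _
    (differentiable_pt_lim_plus _ _ _ _ _ _ _ _
    (differentiable_pt_lim_mult _ _ _ _ _ _ _ _ D1 E2)
    (differentiable_pt_lim_mult _ _ _ _ _ _ _ _ D2 E1)) _ _);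
    unfold Re, Im; simpl; ring.
Qed.

Lemma holomorphic_pow (F : R -> R -> C) (n : nat) (x y : R) :
  holomorphic_at F x y -> holomorphic_at (fun u v => F u v ^ n)%C x y.
Proof.
intro HF; induction n as [|n IH]; simpl.
- apply holomorphic_const.
- apply holomorphic_mult; assumption.
Qed.

Lemma holomorphic_comp (F G : R -> R -> C) (x y : R) :
  holomorphic_at F (Re (G x y)) (Im (G x y)) -> holomorphic_at G x y ->
  holomorphic_at (fun u v => F (Re (G u v)) (Im (G u v))) x y.
Proof.
intros [D [D1 D2]] [E [E1 E2]]; exists (D * E)%C; split.
- refine (differentiable_pt_lim_eq _ _ _ _ _ _ _
    (differentiable_pt_lim_comp _ _ _ _ _ _ _ _ _ _ _ D1 E1 E2) _ _);
    unfold Re, Im; simpl; ring.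
- refine (differentiable_pt_lim_eq _ _ _ _ _ _ _
    (differentiable_pt_lim_comp _ _ _ _ _ _ _ _ _ _ _ D2 E1 E2) _ _);
    unfold Re, Im; simpl; ring.
Qed.

Lemma holomorphic_exp (x y : R) :
  holomorphic_at (fun s t => (exp s * cos t, exp s * sin t)) x y.
Proof.
assert (right : forall g l, derivable_pt_lim g y l ->
  differentiable_pt_lim (fun _ v => g v) x y 0 l).
{ intros g l Hg.
  assert (Hv : differentiable_pt_lim (fun _ v => v) x y 0 1).
  { eapply differentiable_pt_lim_ext; [|apply (differentiable_pt_lim_affine 0 1 0)].
    exists (mkposreal 1 Rlt_0_1); intros; simpl; ring. }
  refine (differentiable_pt_lim_eq _ _ _ _ _ _ _
    (differentiable_pt_lim_comp (fun u _ => g u) _ _ _ _ _ _ _ _ _ _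
    (differentiable_pt_lim_proj1_0 g y y l Hg) Hv Hv) _ _);
    ring. }
assert (He := differentiable_pt_lim_proj1_0 exp x y (exp x) (derivable_pt_lim_exp x)).
exists (exp x * cos y, exp x * sin y); split.
- refine (differentiable_pt_lim_eq _ _ _ _ _ _ _
    (differentiable_pt_lim_mult _ _ _ _ _ _ _ _ He
    (right cos (- sin y) (derivable_pt_lim_cos y))) _ _);
    unfold Re, Im; simpl; ring.
- refine (differentiable_pt_lim_eq _ _ _ _ _ _ _
    (differentiable_pt_lim_mult _ _ _ _ _ _ _ _ He
    (right sin (cos y) (derivable_pt_lim_sin y))) _ _);
    unfold Re, Im; simpl; ring.
Qed.

(** * Concentration of powers of a peak function *)

Lemma continuous_eps_delta (f : R -> R) (x e : R) :
  continuous f x -> 0 < e ->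
  exists d, 0 < d /\ forall t, Rabs (t - x) < d -> Rabs (f t - f x) < e.
Proof.
intros Hf He.
destruct (Hf (fun z => Rabs (z - f x) < e)) as [d Hd].
- exists (mkposreal e He); intros z Hz; exact Hz.
- exists d; split; [apply cond_pos|exact Hd].
Qed.

(** If phi were positive at the peak alpha, the part of the integral close to
    alpha would be at least a constant times q2^n, while the rest is at
    least minus a constant times q1^n, and the whole integral at most a constant
    times q1^n, with q1 < q2. *)
Lemma peak_kernel_nonpos (phi w : R -> R) (c d alpha q M : R) :
  c < alpha < d ->
  (forall t, c <= t <= d -> continuous phi t) ->
  (forall t, c <= t <= d -> continuous w t) ->
  (forall t, c <= t <= d -> 0 <= w t) ->
  w alpha = 1 ->
  (forall delta, 0 < delta -> exists k, k < 1 /\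
     forall t, c <= t <= d -> delta <= Rabs (t - alpha) -> w t <= k) ->
  q < 1 -> 0 <= q ->
  (forall n, Rabs (RInt (fun t => phi t * w t ^ n) c d) <= M * q ^ n) ->
  phi alpha <= 0.
Proof.
intros Hal Cphi Cw Hw0 Hw1 Hpeak Hq1 Hq0 Hint.
destruct (Rle_or_lt (phi alpha) 0) as [H|Hpos]; [exact H|exfalso].
set (m := phi alpha / 2).
assert (Hm : 0 < m) by (unfold m; lra).
assert (Hphi : exists delta, 0 < delta /\
  forall t, Rabs (t - alpha) < delta -> m <= phi t).
{ destruct (continuous_eps_delta phi alpha m (Cphi alpha ltac:(lra)) Hm) as [e [He0 He]].
  exists e; split; [exact He0|]. intros t Ht. specialize (He t Ht).
  apply Rabs_lt_between in He.
  unfold m in *; lra. }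
destruct Hphi as [delta [Hdelta Hphi]].
destruct (Hpeak delta Hdelta) as [k [Hk Hwk]].
set (q1 := Rmax q k).
assert (Hq : q <= q1) by apply Rmax_l.
assert (Hkq : k <= q1) by apply Rmax_r.
assert (Hq1' : q1 < 1) by (apply Rmax_lub_lt; assumption).
(* Any value strictly between q1 and 1 = w alpha would do. *)
set (q2 := (1 + q1) / 2).
assert (Hw : exists eta, 0 < eta /\ forall t, Rabs (t - alpha) < eta -> q2 <= w t).
{ assert (Hp : 0 < 1 - q2) by (unfold q2; lra).
  destruct (continuous_eps_delta w alpha _ (Cw alpha ltac:(lra)) Hp) as [e [He0 He]].
  exists e; split; [exact He0|]. intros t Ht. specialize (He t Ht).
  apply Rabs_lt_between in He.
  lra. }
destruct Hw as [eta [Heta Hw]].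
destruct (bounded_continuity phi c d Cphi) as [K HK].
assert (HK0 : 0 < K) by (apply Rle_lt_trans with (2 := HK alpha ltac:(lra)); apply norm_ge_0).
assert (Hh : exists h, 0 < h /\ h < delta /\ h < eta /\ c <= alpha - h /\ alpha + h <= d).
{ set (h0 := Rmin (Rmin delta eta) (Rmin (alpha - c) (d - alpha))).
  assert (0 < h0) by (unfold h0; repeat apply Rmin_glb_lt; lra).
  assert (h0 <= delta /\ h0 <= eta /\ h0 <= alpha - c /\ h0 <= d - alpha).
  { generalize (Rmin_l (Rmin delta eta) (Rmin (alpha - c) (d - alpha)))
      (Rmin_r (Rmin delta eta) (Rmin (alpha - c) (d - alpha)))
      (Rmin_l delta eta) (Rmin_r delta eta) (Rmin_l (alpha - c) (d - alpha))
      (Rmin_r (alpha - c) (d - alpha)). fold h0. lra. }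
  exists (h0 / 2). lra. }
destruct Hh as [h [Hh0 [Hhd [Hhe [Hhc Hhd']]]]].
assert (Hex : forall n u v, c <= u -> u <= v -> v <= d ->
  ex_RInt (fun t => phi t * w t ^ n) u v).
{ intros n u v Hu Huv Hv. apply (ex_RInt_continuous (V := R_CompleteNormedModule)).
  intros z Hz. rewrite Rmin_left, Rmax_right in Hz by lra.
  apply (continuous_mult (K := R_AbsRing)); [apply Cphi; lra|].
  induction n as [|n IH]; simpl; [apply continuous_const|].
  apply (continuous_mult (K := R_AbsRing)); [apply Cw; lra|exact IH]. }
(* Where phi t is negative, t is at distance at least delta from the peak, so
   w t <= q1. *)
assert (Hlow : forall n t, c <= t <= d -> - K * q1 ^ n <= phi t * w t ^ n).
{ intros n t Ht.
  assert (0 <= w t ^ n) by (apply pow_le, Hw0, Ht).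
  assert (0 <= q1 ^ n) by (apply pow_le; lra).
  destruct (Rlt_or_le (Rabs (t - alpha)) delta) as [Hn|Hf].
  - generalize (Hphi t Hn); intro. nra.
  - assert (w t ^ n <= q1 ^ n).
    { apply pow_incr; split; [apply Hw0, Ht|].
      apply Rle_trans with k; [apply Hwk; assumption|exact Hkq]. }
    generalize (HK t Ht); intro B. apply Rabs_lt_between in B. nra. }
assert (Hside : forall n u v, c <= u -> u <= v -> v <= d ->
  - ((d - c) * K) * q1 ^ n <= RInt (fun t => phi t * w t ^ n) u v).
{ intros n u v Hu Huv Hv.
  apply Rle_trans with (RInt (fun _ => - K * q1 ^ n) u v).
  - rewrite RInt_const. unfold scal; simpl; unfold mult; simpl.
    assert (0 <= K * q1 ^ n) by (apply Rmult_le_pos; [lra|apply pow_le; lra]).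
    nra.
  - apply RInt_le; [exact Huv|apply ex_RInt_const|apply Hex; assumption|].
    intros t Ht; apply Hlow; lra. }
assert (Hmid : forall n, 2 * h * m * q2 ^ n <=
   RInt (fun t => phi t * w t ^ n) (alpha - h) (alpha + h)).
{ intro n. apply Rle_trans with (RInt (fun _ => m * q2 ^ n) (alpha - h) (alpha + h)).
  - rewrite RInt_const. unfold scal; simpl; unfold mult; simpl. right; ring.
  - apply RInt_le; [lra|apply ex_RInt_const|apply Hex; lra|].
    intros t Ht. apply Rmult_le_compat; [lra|apply pow_le; unfold q2; lra| |].
    + apply Hphi, Rabs_lt_between; lra.
    + apply pow_incr; split; [unfold q2; lra|]. apply Hw, Rabs_lt_between; lra. }
set (A := Rabs M + 2 * ((d - c) * K)).
assert (HA : 0 <= A).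
{ unfold A. generalize (Rabs_pos M). assert (0 <= (d - c) * K) by nra. lra. }
assert (Hall : forall n, 2 * h * m * q2 ^ n <= A * q1 ^ n).
{ intro n.
  assert (Hsum : RInt (fun t => phi t * w t ^ n) c d =
    RInt (fun t => phi t * w t ^ n) c (alpha - h) +
    (RInt (fun t => phi t * w t ^ n) (alpha - h) (alpha + h) +
     RInt (fun t => phi t * w t ^ n) (alpha + h) d)).
  { rewrite <- (RInt_Chasles _ c (alpha - h) d) by (apply Hex; lra).
    rewrite <- (RInt_Chasles _ (alpha - h) (alpha + h) d) by (apply Hex; lra).
    reflexivity. }
  specialize (Hint n). rewrite Hsum in Hint.
  apply Rabs_le_between in Hint.
  generalize (Hside n c (alpha - h) ltac:(lra) ltac:(lra) ltac:(lra))
    (Hside n (alpha + h) d ltac:(lra) ltac:(lra) ltac:(lra)) (Hmid n); intros.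
  assert (M * q ^ n <= Rabs M * q1 ^ n).
  { apply Rle_trans with (Rabs M * q ^ n).
    - apply Rmult_le_compat_r; [apply pow_le; lra|apply Rle_abs].
    - apply Rmult_le_compat_l; [apply Rabs_pos|apply pow_incr; lra]. }
  unfold A. lra. }
assert (Hq2 : 0 < q2) by (unfold q2; lra).
assert (Hr : Rabs (q1 / q2) < 1).
{ rewrite Rabs_pos_eq by (apply Rdiv_le_0_compat; lra).
  apply Rlt_div_l; unfold q2; lra. }
assert (Hc0 : 0 < 2 * h * m) by (repeat apply Rmult_lt_0_compat; lra).
destruct (pow_lt_1_zero _ Hr (2 * h * m / (A + 1))) as [N HN].
{ apply Rdiv_lt_0_compat; lra. }
specialize (HN N (Nat.le_refl N)). apply Rabs_lt_between in HN.
destruct HN as [_ HN]. apply Rlt_div_r in HN; [|lra].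
assert (Hpw : 0 < q2 ^ N) by (apply pow_lt; exact Hq2).
assert (E : q1 ^ N = (q1 / q2) ^ N * q2 ^ N).
{ rewrite <- Rpow_mult_distr. f_equal. field; lra. }
assert (0 <= (q1 / q2) ^ N) by (apply pow_le, Rdiv_le_0_compat; lra).
generalize (Hall N). rewrite E. intro HF.
assert (2 * h * m <= A * (q1 / q2) ^ N).
{ apply Rmult_le_reg_r with (q2 ^ N); [exact Hpw|lra]. }
nra.
Qed.

(** A peak function w separates the value of phi at its peak from the integrals of
    phi w^n: these cannot decay geometrically unless phi vanishes there. *)
Lemma peak_kernel (phi w : R -> R) (c d alpha q M : R) :
  c < alpha < d ->
  (forall t, c <= t <= d -> continuous phi t) ->
  (forall t, c <= t <= d -> continuous w t) ->
  (forall t, c <= t <= d -> 0 <= w t) ->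
  w alpha = 1 ->
  (forall delta, 0 < delta -> exists k, k < 1 /\
     forall t, c <= t <= d -> delta <= Rabs (t - alpha) -> w t <= k) ->
  q < 1 -> 0 <= q ->
  (forall n, Rabs (RInt (fun t => phi t * w t ^ n) c d) <= M * q ^ n) ->
  phi alpha = 0.
Proof.
intros Hal Cphi Cw Hw0 Hw1 Hpeak Hq1 Hq0 Hint.
assert (H1 := peak_kernel_nonpos phi w c d alpha q M Hal Cphi Cw Hw0 Hw1 Hpeak Hq1 Hq0 Hint).
assert (H2 : - phi alpha <= 0); [|lra].
apply (peak_kernel_nonpos (fun t => - phi t) w c d alpha q M); try assumption.
- intros t Ht. apply (continuous_opp (V := R_NormedModule)), Cphi, Ht.
- intro n.
  replace (RInt (fun t => - phi t * w t ^ n) c d)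
    with (- RInt (fun t => phi t * w t ^ n) c d); [rewrite Rabs_Ropp; apply Hint|].
  symmetry. rewrite (RInt_ext _ (fun t => opp (phi t * w t ^ n)))
    by (intros; unfold opp; simpl; ring).
  apply (RInt_opp (V := R_CompleteNormedModule)).
  apply (ex_RInt_continuous (V := R_CompleteNormedModule)).
  intros z Hz. rewrite Rmin_left, Rmax_right in Hz by lra.
  apply (continuous_mult (K := R_AbsRing)); [apply Cphi; lra|].
  induction n as [|n IH]; simpl; [apply continuous_const|].
  apply (continuous_mult (K := R_AbsRing)); [apply Cw; lra|exact IH].
Qed.

(** * The identity principle *)

Lemma holomorphic_continuous (F : R -> R -> C) (x y : R) :
  holomorphic_at F x y ->
  continuous (fun v => Re (F x v)) y /\ continuous (fun v => Im (F x v)) y.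
Proof.
intros [D [D1 D2]]; split.
- apply (continuity_2d_pt_right (fun u v => Re (F u v))), differentiable_continuity_pt.
  eexists; eexists; exact D1.
- apply (continuity_2d_pt_right (fun u v => Im (F u v))), differentiable_continuity_pt.
  eexists; eexists; exact D2.
Qed.

(** Im (F dz) = Im F dx + Re F dy; its closedness is one of the two
    Cauchy-Riemann equations. *)
Lemma holomorphic_closed (F : R -> R -> C) (x y : R) :
  holomorphic_at F x y ->
  closed_form_at (fun u v => Im (F u v)) (fun u v => Re (F u v)) x y.
Proof. intros [D [D1 D2]]. exists (Im D), (Re D), (- Im D). split; assumption. Qed.

(** The factor 10 makes the range of t short compared with the length in s, so
    that the square of ((s + i (t - alpha)) / length) is close to 1 on the left
    side s = - length and small on the right side s = 0. *)
Definition rectangle_length : R := 10 * PI.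

(** W = (1 + 2 w^2) (1 - w^2) with w = (s + i (t - alpha)) / S.  On s = 0, w is
    imaginary and w^2 <= 0, so that W is real and the first factor creates the
    maximum at w = 0.  As |W| is even in s, the maximum principle forces |W| > 1
    somewhere to the left of it; the second factor makes W small again near
    w = -1. *)
Definition strip_weight (alpha s t : R) : C :=
  let w := (RtoC (/ rectangle_length) * ((s, t) + (0, (- alpha)%R)))%C in
  ((1 + RtoC 2 * (w * w)) * (1 + RtoC (-1) * (w * w)))%C.

Lemma strip_weight_holomorphic (alpha x y : R) :
  holomorphic_at (strip_weight alpha) x y.
Proof.
assert (Hw : holomorphic_at
  (fun s t => (RtoC (/ rectangle_length) * ((s, t) + (0, (- alpha)%R)))%C) x y).
{ apply holomorphic_mult; [apply holomorphic_const|].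
  apply holomorphic_plus; [apply holomorphic_id|apply holomorphic_const]. }
unfold strip_weight.
apply holomorphic_mult; apply holomorphic_plus; try apply holomorphic_const;
  apply holomorphic_mult; try apply holomorphic_const; apply holomorphic_mult; exact Hw.
Qed.

Definition peak (alpha t : R) : R :=
  let v := ((t - alpha) / rectangle_length) ^ 2 in (1 - 2 * v) * (1 + v).

Lemma strip_weight_right (alpha t : R) :
  strip_weight alpha 0 t = RtoC (peak alpha t).
Proof.
unfold strip_weight, peak, Rdiv. generalize (/ rectangle_length); intro k.
apply injective_projections; simpl; ring.
Qed.

Lemma strip_offset (alpha t : R) :
  0 < alpha < PI -> 0 <= t <= PI ->
  0 <= ((t - alpha) / rectangle_length) ^ 2 <= / 100.
Proof.
intros Ha Ht. split; [apply pow2_ge_0|].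
assert (HP := PI_RGT_0).
replace (/ 100) with ((/ 10) ^ 2) by lra.
apply pow_maj_Rabs. unfold Rdiv. rewrite Rabs_mult.
rewrite (Rabs_pos_eq (/ _)) by (apply Rlt_le, Rinv_0_lt_compat; unfold rectangle_length; lra).
apply Rle_div_l; unfold rectangle_length; [lra|].
apply Rabs_le_between; lra.
Qed.

Lemma strip_weight_left (alpha t : R) :
  0 < alpha < PI -> 0 <= t <= PI ->
  Cmod (strip_weight alpha (- rectangle_length) t) <= 7 / 10.
Proof.
intros Ha Ht. generalize (strip_offset alpha t Ha Ht).
assert (HP := PI_RGT_0).
set (z := strip_weight _ _ _). set (u := (t - alpha) / rectangle_length).
intros [H1 H2].
(* With w = -1 + i u: |1 - w^2|^2 = u^4 + 4 u^2 and
   |1 + 2 w^2|^2 = 9 + 4 u^2 + 4 u^4. *)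
assert (E : Cmod z ^ 2 = (u ^ 4 + 4 * u ^ 2) * (9 + 4 * u ^ 2 + 4 * u ^ 4)).
{ rewrite Cmod2_alt. unfold z, strip_weight, Re, Im, u; simpl.
  field. unfold rectangle_length; lra. }
assert (Cmod z ^ 2 <= (7 / 10) ^ 2).
{ rewrite E. replace (u ^ 4) with (u ^ 2 * u ^ 2) by ring.
  set (v := u ^ 2) in *. clearbody v. nra. }
generalize (Cmod_ge_0 z). nra.
Qed.

(** Goursat's theorem for G W^n, where G is F in the coordinates
    (s, t) with x + iy = rho e^(s + it), compares the sides s = 0 and s = - S,
    because G vanishes on t = 0 and t = pi. *)
Lemma polar_zero (F : R -> R -> C) (r rho alpha : R) :
  (forall x y, x ^ 2 + y ^ 2 < r ^ 2 -> holomorphic_at F x y) ->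
  (forall x, x ^ 2 < r ^ 2 -> F x 0 = 0%C) ->
  0 < rho < r -> 0 < alpha < PI ->
  Re (F (rho * cos alpha) (rho * sin alpha)) = 0.
Proof.
intros Hholo Hzero Hrho Halpha.
assert (HP := PI_RGT_0).
set (S := rectangle_length).
assert (HS : 0 < S) by (unfold S, rectangle_length; lra).
assert (HS' : - S <= 0) by lra.
set (E := fun s t => (RtoC rho * (exp s * cos t, exp s * sin t)%R)%C).
set (G := fun s t => F (Re (E s t)) (Im (E s t))).
assert (Emod : forall s t, s <= 0 -> (Re (E s t)) ^ 2 + (Im (E s t)) ^ 2 < r ^ 2).
{ intros s t Hs. unfold E, Re, Im; simpl.
  replace (_ + _) with ((rho * exp s) ^ 2 * ((sin t) ^ 2 + (cos t) ^ 2)) by ring.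
  rewrite <- !Rsqr_pow2, sin2_cos2, !Rsqr_pow2.
  assert (exp s <= 1) by (destruct Hs as [Hs| ->]; [apply exp_increasing in Hs|]; rewrite exp_0 in *; lra).
  generalize (exp_pos s); intro.
  assert (0 < rho * exp s <= rho) by nra. nra. }
assert (HG : forall s t, s <= 0 -> holomorphic_at G s t).
{ intros s t Hs. apply (holomorphic_comp F E); [apply Hholo, Emod, Hs|].
  apply holomorphic_mult; [apply holomorphic_const|apply holomorphic_exp]. }
assert (HGW : forall n s t, s <= 0 ->
  holomorphic_at (fun s t => G s t * strip_weight alpha s t ^ n)%C s t).
{ intros n s t Hs. apply holomorphic_mult; [apply HG, Hs|].
  apply holomorphic_pow, strip_weight_holomorphic. }
assert (G0 : forall s t, s <= 0 -> sin t = 0 -> G s t = 0%C).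
{ intros s t Hs Ht. generalize (Emod s t Hs).
  assert (HI : Im (E s t) = 0) by (unfold E, Im; simpl; rewrite Ht; ring).
  unfold G. rewrite HI. intro Hr. apply Hzero. lra. }
assert (Hbound : exists K, 0 <= K /\ forall t, 0 <= t <= PI -> Cmod (G (- S) t) <= K).
{ destruct (bounded_continuity (fun t => Re (G (- S) t)) 0 PI) as [K1 H1].
  { intros t _. apply holomorphic_continuous, HG; lra. }
  destruct (bounded_continuity (fun t => Im (G (- S) t)) 0 PI) as [K2 H2].
  { intros t _. apply holomorphic_continuous, HG; lra. }
  assert (B : forall t, 0 <= t <= PI -> Cmod (G (- S) t) <= K1 + K2).
  { intros t Ht.
    replace (G (- S) t) with (RtoC (Re (G (- S)%R t)) + Ci * RtoC (Im (G (- S)%R t)))%C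
      by (apply injective_projections; simpl; unfold Re, Im; ring).
    eapply Rle_trans; [apply Cmod_triangle|].
    rewrite Cmod_mult, Cmod_Ci, Rmult_1_l, !Cmod_R.
    apply Rplus_le_compat; [apply Rlt_le, (H1 t Ht)|apply Rlt_le, (H2 t Ht)]. }
  exists (K1 + K2); split; [|exact B].
  apply Rle_trans with (2 := B 0 ltac:(lra)), Cmod_ge_0. }
destruct Hbound as [K [HK0 HK]].
assert (cont : forall n s t, s <= 0 ->
  continuous (fun t => Re (G s t * strip_weight alpha s t ^ n)%C) t).
{ intros n s t Hs. apply (holomorphic_continuous _ _ _ (HGW n s t Hs)). }
assert (Hint : forall n,
  Rabs (RInt (fun t => Re (G 0 t) * peak alpha t ^ n) 0 PI) <= PI * K * (7 / 10) ^ n).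
{ intro n.
  assert (HI := Goursat_rectangle
    (fun s t => Im (G s t * strip_weight alpha s t ^ n)%C)
    (fun s t => Re (G s t * strip_weight alpha s t ^ n)%C) (- S) 0 0 PI
    ltac:(lra) ltac:(lra)
    (fun s t Hs Ht => holomorphic_closed _ s t (HGW n s t ltac:(lra)))).
  unfold rectangle_integral in HI.
  rewrite (RInt_ext (fun s => _ - _) (fun _ => 0)) in HI.
  2: { intros s Hs. rewrite Rmin_left, Rmax_right in Hs by lra.
       rewrite (G0 s 0), (G0 s PI) by (try lra; try apply sin_0; apply sin_PI).
       unfold Im; simpl; ring. }
  rewrite RInt_const in HI.
  rewrite (RInt_minus (V := R_CompleteNormedModule)
    (fun t => Re (G 0 t * strip_weight alpha 0 t ^ n)%C)
    (fun t => Re (G (- S)%R t * strip_weight alpha (- S)%R t ^ n)%C)) in HI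
    by (apply (ex_RInt_continuous (V := R_CompleteNormedModule)); intros; apply cont; lra).
  change ((0 - - S) * 0 +
    (RInt (fun t => Re (G 0 t * strip_weight alpha 0 t ^ n)%C) 0 PI -
     RInt (fun t => Re (G (- S)%R t * strip_weight alpha (- S)%R t ^ n)%C) 0 PI) = 0) in HI.
  rewrite (RInt_ext _ (fun t => Re (G 0 t * strip_weight alpha 0 t ^ n)%C)).
  2: { intros t _. rewrite strip_weight_right, <- RtoC_pow. unfold Re; simpl; ring. }
  replace (RInt _ _ _) with (RInt (fun t => Re (G (- S)%R t * strip_weight alpha (- S)%R t ^ n)%C) 0 PI)
    by lra.
  rewrite Rmult_assoc. replace PI with (PI - 0) at 2 by ring.
  apply abs_RInt_le_const; [lra| |].
  - apply (ex_RInt_continuous (V := R_CompleteNormedModule)); intros; apply cont; lra.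
  - intros t Ht. eapply Rle_trans; [apply re_le_Cmod|].
    rewrite Cmod_mult, Cmod_pow.
    apply Rmult_le_compat; [apply Cmod_ge_0|apply pow_le, Cmod_ge_0|apply HK, Ht|].
    apply pow_incr; split; [apply Cmod_ge_0|apply strip_weight_left; assumption]. }
assert (Hres : Re (G 0 alpha) = 0).
{ apply (peak_kernel (fun t => Re (G 0 t)) (peak alpha) 0 PI alpha (7 / 10) (PI * K));
    [exact Halpha| | | | | |lra|lra|exact Hint].
  - intros t _. apply holomorphic_continuous, HG; lra.
  - intros t _. apply (ex_derive_continuous (V := R_NormedModule)).
    unfold peak. auto_derive. exact I.
  - intros t Ht. generalize (strip_offset alpha t Halpha Ht). unfold peak. nra.
  - unfold peak. rewrite Rminus_diag. unfold Rdiv. rewrite Rmult_0_l. ring.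
  - intros delta Hdelta. exists (1 - (delta / S) ^ 2).
    assert (0 < delta / S) by (apply Rdiv_lt_0_compat; assumption).
    split; [nra|]. intros t Ht Hd. unfold peak. fold S.
    assert ((delta / S) ^ 2 <= ((t - alpha) / S) ^ 2).
    { rewrite <- (pow2_abs ((t - alpha) / S)). apply pow_incr; split; [lra|].
      unfold Rdiv. rewrite Rabs_mult, (Rabs_pos_eq (/ S)) by (apply Rlt_le, Rinv_0_lt_compat, HS).
      apply Rmult_le_compat_r; [apply Rlt_le, Rinv_0_lt_compat, HS|exact Hd]. }
    generalize (pow2_ge_0 ((t - alpha) / S)). nra. }
rewrite <- Hres. unfold G, E, Re, Im; simpl. rewrite exp_0. do 2 f_equal; ring.
Qed.

(** The imaginary part of F vanishes as well: replace F by - i F. *)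
Lemma identity_theorem_upper (F : R -> R -> C) (r x y : R) :
  (forall x y, x ^ 2 + y ^ 2 < r ^ 2 -> holomorphic_at F x y) ->
  (forall x, x ^ 2 < r ^ 2 -> F x 0 = 0%C) ->
  0 <= r -> 0 < y -> x ^ 2 + y ^ 2 < r ^ 2 -> Re (F x y) = 0.
Proof.
intros Hholo Hzero Hr Hy Hxy.
set (rho := sqrt (x ^ 2 + y ^ 2)).
assert (Hpos : 0 < x ^ 2 + y ^ 2) by nra.
assert (Hrho2 : rho ^ 2 = x ^ 2 + y ^ 2) by (apply pow2_sqrt; lra).
assert (Hrho : 0 < rho) by (apply sqrt_lt_R0; exact Hpos).
assert (Hrho' : rho < r) by nra.
assert (Hq : -1 < x / rho < 1).
{ split; [apply Rlt_div_r|apply Rlt_div_l]; try lra; nra. }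
assert (Hcos : rho * cos (acos (x / rho)) = x).
{ rewrite cos_acos by lra. field; lra. }
assert (Hsin : rho * sin (acos (x / rho)) = y).
{ rewrite sin_acos by lra.
  replace (1 - Rsqr (x / rho)) with ((y / rho) ^ 2).
  - rewrite sqrt_pow2; [field; lra|]. apply Rdiv_le_0_compat; lra.
  - unfold Rsqr. replace (y ^ 2) with (rho ^ 2 - x ^ 2) by lra.
    unfold Rdiv. rewrite Rpow_mult_distr. replace (y ^ 2) with (rho ^ 2 - x ^ 2) by lra.
    field; lra. }
rewrite <- Hcos, <- Hsin. apply (polar_zero F r); try assumption; [lra|].
apply acos_bound_lt; exact Hq.
Qed.

(** * Quaternions and slices *)

Lemma H_eq (p q : H) :
  fst (fst (fst p)) = fst (fst (fst q)) -> snd (fst (fst p)) = snd (fst (fst q)) ->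
  snd (fst p) = snd (fst q) -> snd p = snd q -> p = q.
Proof.
destruct p as [[[? ?] ?] ?], q as [[[? ?] ?] ?]; simpl; intros -> -> -> ->; reflexivity.
Qed.

Ltac H_ring :=
  repeat match goal with q : H |- _ => destruct q as [[[? ?] ?] ?] end;
  unfold Hone, RtoH; apply H_eq; cbn; unfold plus, opp; cbn; field.

Lemma imag_unit_coordinates (I : H) :
  imag_unit I -> exists b c d, I = (0, b, c, d) /\ b ^ 2 + c ^ 2 + d ^ 2 = 1.
Proof.
destruct I as [[[a b] c] d]; unfold imag_unit; intro E.
assert (E0 := f_equal (fun q : H => fst (fst (fst q))) E).
assert (E1 := f_equal (fun q : H => snd (fst (fst q))) E).
assert (E2 := f_equal (fun q : H => snd (fst q)) E).
assert (E3 := f_equal (fun q : H => snd q) E).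
cbn in E0, E1, E2, E3; unfold opp in E0, E1, E2, E3; cbn in E0, E1, E2, E3.
assert (Ha : a = 0).
{ destruct (Req_dec a 0) as [Ha|Ha]; [exact Ha|exfalso].
  assert (b = 0) by (apply (Rmult_eq_reg_l a); [lra|exact Ha]).
  assert (c = 0) by (apply (Rmult_eq_reg_l a); [lra|exact Ha]).
  assert (d = 0) by (apply (Rmult_eq_reg_l a); [lra|exact Ha]).
  subst. nra. }
subst a. exists b, c, d; split; [reflexivity|lra].
Qed.

Lemma imag_unit_opp (I : H) : imag_unit I -> imag_unit (- I)%H.
Proof.
unfold imag_unit; intro HI. rewrite <- HI. H_ring.
Qed.

Lemma slice_norm (I : H) (x y : R) :
  imag_unit I -> Hnorm (slice x y I) = sqrt (x ^ 2 + y ^ 2).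
Proof.
intro HI. destruct (imag_unit_coordinates I HI) as [b [c [d [-> E]]]].
cbn; unfold plus; cbn. f_equal.
transitivity (x ^ 2 + y ^ 2 * (b ^ 2 + c ^ 2 + d ^ 2)); [ring|rewrite E; ring].
Qed.

Lemma slice_opp (I : H) (x y : R) : slice x (- y) (- I)%H = slice x y I.
Proof. unfold slice. H_ring. Qed.

Lemma Hball_slice (r x y : R) (I : H) :
  0 < r -> imag_unit I -> Hball r (slice x y I) <-> x ^ 2 + y ^ 2 < r ^ 2.
Proof.
intros Hr HI. unfold Hball. rewrite (slice_norm I x y HI).
assert (H0 : 0 <= x ^ 2 + y ^ 2) by nra.
split; intro Hlt.
- rewrite <- (pow2_sqrt (x ^ 2 + y ^ 2) H0). generalize (sqrt_pos (x ^ 2 + y ^ 2)). nra.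
- rewrite <- (sqrt_pow2 r) by lra. apply sqrt_lt_1; nra.
Qed.

(** The norm is multiplicative by the four-square identity, so left
    multiplication is bounded. *)
Lemma is_linear_Hmult (p : H) : is_linear (fun q : H_NormedModule => (p * q)%H).
Proof.
split.
- intros q s. apply (mult_distr_l (K := H_Ring)).
- intros k q. unfold scal. destruct p as [[[? ?] ?] ?], q as [[[? ?] ?] ?].
  apply H_eq; cbn; unfold scal; cbn; unfold mult; cbn; ring.
- exists (Hnorm p + 1). 
  assert (Hp : 0 <= Hnorm p) by (rewrite Hnorm_norm; apply norm_ge_0).
  split; [lra|]. intro q.
  assert (E : Hnorm (p * q)%H = Hnorm p * Hnorm q).
  { destruct p as [[[a b] c] d], q as [[[a' b'] c'] d']; cbn.
    rewrite <- sqrt_mult by nra. f_equal. ring. }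
  rewrite <- !Hnorm_norm, E.
  apply Rmult_le_compat_r; [rewrite Hnorm_norm; apply norm_ge_0|lra].
Qed.

Lemma coordinates_separate (p q : H) :
  (forall l : H_NormedModule -> R_NormedModule, is_linear l -> l p = l q) -> p = q.
Proof.
intro E.
assert (L3 : is_linear (fun q : H_NormedModule => fst q)) by exact is_linear_fst.
assert (L2 : is_linear (fun q : H_NormedModule => fst (fst q)))
  by exact (is_linear_comp _ _ L3 is_linear_fst).
apply H_eq.
- apply (E (fun q => fst (fst (fst q)))). exact (is_linear_comp _ _ L2 is_linear_fst).
- apply (E (fun q => snd (fst (fst q)))). exact (is_linear_comp _ _ L2 is_linear_snd).
- apply (E (fun q => snd (fst q))). exact (is_linear_comp _ _ L3 is_linear_snd).
- apply (E (fun q => snd q)). exact is_linear_snd.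
Qed.

Lemma is_derive_H_unique (f : R -> H) (x : R) (d d' : H) :
  is_derive (V := H_NormedModule) f x d -> is_derive (V := H_NormedModule) f x d' -> d = d'.
Proof.
intros Hd Hd'. apply coordinates_separate; intros l Hl.
assert (go : forall e : H, is_derive (V := H_NormedModule) f x e ->
  is_derive (fun t => l (f t)) x (l e)).
{ intros e He. unfold is_derive.
  apply filterdiff_ext_lin with (fun t : R => l (scal t e)).
  - apply (filterdiff_comp' f l x _ l He), filterdiff_linear, Hl.
  - intro t. apply (linear_scal l Hl). }
rewrite <- (is_derive_unique _ _ _ (go d Hd)).
apply (is_derive_unique _ _ _ (go d' Hd')).
Qed.

(** * Functions holomorphic for left multiplication by an imaginary unit *)

(** The differential of h is s, t |-> (s + t I) D, which packs real
    differentiability and the Cauchy-Riemann equation dh/dy = I dh/dx. *)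
Definition left_holomorphic_at (I : H) (h : R -> R -> H) (x y : R) : Prop :=
  exists D : H, filterdiff (V := H_NormedModule)
    (fun z : R * R => h (fst z) (snd z)) (locally (x, y))
    (fun z : R * R => plus (scal (fst z) D) (scal (snd z) (I * D)%H)).

(** The differential of f at a point composed with the slice map is the required
    differential: the partial derivatives provided by regularity are its values
    at 1 and I. *)
Lemma regular_slice (r : R) (f : H -> H) (I : H) (x y : R) :
  0 < r -> regular (Hball r) f -> imag_unit I -> x ^ 2 + y ^ 2 < r ^ 2 ->
  left_holomorphic_at I (fun x y => f (slice x y I)) x y.
Proof.
intros Hr [Hdiff Hcr] HI Hxy.
assert (Hball := proj2 (Hball_slice r x y I Hr HI) Hxy).
destruct (Hdiff _ Hball) as [l Hl].
destruct (Hcr I HI x y Hball) as [fx [fy [Hx [Hy E]]]].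
assert (Hlin : is_linear l) by exact (proj1 Hl).
(* f along a line with direction v has derivative l v. *)
assert (line : forall (g : R -> H) (k v : H) (t : R),
  (forall s, g s = plus (scal s v) k) -> g t = slice x y I ->
  is_derive (V := H_NormedModule) (fun s => f (g s)) t (l v)).
{ intros g k v t Hg Hgt.
  assert (Dg : filterdiff (V := H_NormedModule) g (locally t) (fun s : R => scal s v)).
  { apply filterdiff_ext with (fun s : R => plus (scal s v) k); [intro s; symmetry; apply Hg|].
    apply filterdiff_ext_lin with (fun s : R => plus (scal s v) zero);
      [|intro s; apply plus_zero_r].
    apply (filterdiff_plus_fct (U := AbsRing_NormedModule R_AbsRing) (V := H_NormedModule)
      (fun s : R => scal s v) (fun _ => k) (fun s : R => scal s v) (fun _ => zero)).
    - apply filterdiff_linear. exact (is_linear_scal_l (V := H_NormedModule) v).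
    - apply filterdiff_const. }
  unfold is_derive.
  apply filterdiff_ext_lin with (fun s : R => l (scal s v)).
  - apply (filterdiff_comp' g f t _ l Dg). rewrite Hgt. exact Hl.
  - intro s. apply (linear_scal l Hlin). }
assert (Ex : fx = l Hone).
{ apply (is_derive_H_unique _ _ _ _ Hx), (line _ (RtoH y * I)%H); [|reflexivity].
  intro s. unfold slice, scal. H_ring. }
assert (Ey : fy = l I).
{ apply (is_derive_H_unique _ _ _ _ Hy), (line _ (RtoH x)); [|reflexivity].
  intro s. unfold slice, scal. H_ring. }
assert (E' : fy = (I * fx)%H).
{ assert (E0 : (fx + I * fy)%H = 0%H).
  { revert E. generalize (fx + I * fy)%H as q. intros q E.
    destruct q as [[[q0 q1] q2] q3].
    assert (E1 := f_equal (fun q : H => fst (fst (fst q))) E).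
    assert (E2 := f_equal (fun q : H => snd (fst (fst q))) E).
    assert (E3 := f_equal (fun q : H => snd (fst q)) E).
    assert (E4 := f_equal (fun q : H => snd q) E).
    cbn in E1, E2, E3, E4. apply H_eq; cbn; lra. }
  transitivity (I * (fx + I * fy) + - (I * I * fy))%H; [|clear; H_ring].
  rewrite E0. unfold imag_unit in HI. rewrite HI. clear; H_ring. }
exists fx.
set (sigma := fun z : R * R => slice (fst z) (snd z) I).
assert (Hsigma : is_linear sigma).
{ apply is_linear_ext with (fun z : R * R => plus (scal (fst z) Hone) (scal (snd z) I)).
  - intros [s t]. unfold sigma, slice, scal; simpl. H_ring.
  - apply (is_linear_comp (fun z : R * R => (scal (fst z) Hone, scal (snd z) I))
      (fun u : H * H => plus (fst u) (snd u))); [|exact is_linear_plus].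
    apply is_linear_prod.
    + apply (is_linear_comp (fun z : R * R => fst z) (fun s : R => scal s Hone));
        [exact is_linear_fst|exact (is_linear_scal_l (V := H_NormedModule) Hone)].
    + apply (is_linear_comp (fun z : R * R => snd z) (fun s : R => scal s I));
        [exact is_linear_snd|exact (is_linear_scal_l (V := H_NormedModule) I)]. }
apply filterdiff_ext_lin with (fun z => l (sigma z)).
- apply (filterdiff_comp' sigma f (x, y) sigma l); [|exact Hl].
  apply filterdiff_linear, Hsigma.
- intros [s t]; simpl. rewrite <- E', Ex, Ey, <- !(linear_scal l Hlin), <- (linear_plus l Hlin).
  f_equal. unfold sigma, slice, scal; simpl. H_ring.
Qed.

(** Left multiplication does not respect left holomorphy in general; it does,
    with a change of unit, when the factor intertwines the two units. *)
Lemma left_holomorphic_Hmult (I J e : H) (h : R -> R -> H) (x y : R) :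
  (e * J = I * e)%H -> left_holomorphic_at J h x y ->
  left_holomorphic_at I (fun x y => e * h x y)%H x y.
Proof.
intros E [D HD]. exists (e * D)%H.
apply filterdiff_ext_lin with
  (fun z : R * R => (e * (plus (scal (fst z) D) (scal (snd z) (J * D))))%H).
- apply (filterdiff_comp' (fun z : R * R => h (fst z) (snd z)) (fun q : H => (e * q)%H)
    (x, y) _ _ HD).
  apply filterdiff_linear, is_linear_Hmult.
- intro z. rewrite (linear_plus _ (is_linear_Hmult e)), !(linear_scal _ (is_linear_Hmult e)).
  do 2 f_equal.
  etransitivity; [apply (mult_assoc (K := H_Ring))|]. rewrite E.
  symmetry; apply (mult_assoc (K := H_Ring)).
Qed.

Lemma left_holomorphic_plus (I : H) (g h : R -> R -> H) (x y : R) :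
  left_holomorphic_at I g x y -> left_holomorphic_at I h x y ->
  left_holomorphic_at I (fun x y => g x y + h x y)%H x y.
Proof.
intros [D HD] [E HE]. exists (D + E)%H.
eapply filterdiff_ext_lin; [exact (filterdiff_plus_fct _ _ _ _ HD HE)|].
intro z; simpl. destruct z as [s t]; simpl.
unfold scal. H_ring.
Qed.

(** q |-> l q - i l (I q) is a complex-linear map from the quaternions, with I
    acting on the left, to the complex numbers, for every real-linear form l. *)
Lemma left_holomorphic_coordinate (I : H) (h : R -> R -> H) (l : H_NormedModule -> R_NormedModule)
  (x y : R) :
  imag_unit I -> is_linear l -> left_holomorphic_at I h x y ->
  holomorphic_at (fun x y => (l (h x y), - l (I * h x y)%H)) x y.
Proof.
intros HI Hl [D HD]. exists (l D, - l (I * D)%H).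
assert (HII : forall q : H, (I * (I * q))%H = (- q)%H).
{ intro q. etransitivity; [apply (mult_assoc (K := H_Ring))|]. rewrite HI. H_ring. }
assert (go : forall k : H_NormedModule -> R_NormedModule, is_linear k ->
  differentiable_pt_lim (fun u v => k (h u v)) x y (k D) (k (I * D)%H)).
{ intros k Hk. apply filterdiff_differentiable_pt_lim.
  eapply filterdiff_ext_lin;
    [apply (filterdiff_comp' (fun z : R * R => h (fst z) (snd z)) k (x, y) _ k HD),
       filterdiff_linear, Hk|].
  intro z; cbv beta. rewrite (linear_plus k Hk), !(linear_scal k Hk). reflexivity. }
split; unfold Re, Im; simpl.
- rewrite Ropp_involutive. exact (go l Hl).
- assert (Hk : is_linear (fun q : H_NormedModule => opp (l (I * q)%H))).
  { apply (is_linear_comp _ _ (is_linear_comp _ _ (is_linear_Hmult I) Hl)).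
    apply is_linear_opp. }
  refine (differentiable_pt_lim_eq _ _ _ _ _ _ _ (go _ Hk) _ _); [reflexivity|].
  cbv beta. rewrite HII.
  transitivity (opp (opp (l D))); [f_equal; apply (linear_opp l D Hl)|apply opp_opp].
Qed.

(** Real-linear forms separate points, so the identity principle for complex
    functions suffices. *)
Lemma left_holomorphic_zero (I : H) (h : R -> R -> H) (r x y : R) :
  0 < r -> imag_unit I ->
  (forall x y, x ^ 2 + y ^ 2 < r ^ 2 -> left_holomorphic_at I h x y) ->
  (forall x, x ^ 2 < r ^ 2 -> h x 0 = 0%H) ->
  0 <= y -> x ^ 2 + y ^ 2 < r ^ 2 -> h x y = 0%H.
Proof.
intros Hr HI Hholo Hreal [Hy|<-] Hxy; [|apply Hreal; lra].
apply coordinates_separate; intros l Hl.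
transitivity 0; [|symmetry; exact (linear_zero l Hl)].
apply (identity_theorem_upper (fun x y => (l (h x y), - l (I * h x y)%H)) r x y);
  try assumption; [| |lra].
- intros u v Huv. apply left_holomorphic_coordinate; auto.
- intros u Hu. rewrite (Hreal u Hu).
  assert (HI0 : (I * 0)%H = 0%H) by exact (mult_zero_r (K := H_Ring) I).
  rewrite HI0.
  assert (Hl0 : l 0%H = 0) by exact (linear_zero l Hl).
  apply injective_projections; simpl; [exact Hl0|].
  transitivity (- 0); [f_equal; exact Hl0|apply Ropp_0].
Qed.

(** * The representation formula *)

(** The weights of f(x + yJ) and f(x - yJ); for J = I they are 1 and 0. *)
Definition same_side (I J : H) : H := (RtoH (1 / 2) * (Hone + - (I * J)))%H.
Definition other_side (I J : H) : H := (RtoH (1 / 2) * (Hone + I * J))%H.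

(** Both products equal (I + J) / 2. *)
Lemma same_side_intertwines (I J : H) :
  imag_unit I -> imag_unit J -> (same_side I J * J = I * same_side I J)%H.
Proof.
intros HI HJ.
unfold imag_unit, same_side in *.
transitivity (RtoH (1 / 2) * (J + - (I * (J * J))))%H; [clear; H_ring|].
transitivity (RtoH (1 / 2) * (I + - (I * I * J)))%H; [|clear; H_ring].
rewrite HI, HJ. clear; H_ring.
Qed.

(** The weight of x - yJ for the unit J is the weight of x + yJ for - J. *)
Lemma other_side_intertwines (I J : H) :
  imag_unit I -> imag_unit J -> (other_side I J * - J = I * other_side I J)%H.
Proof.
intros HI HJ.
transitivity (same_side I (- J)%H * - J)%H; [unfold other_side, same_side; clear; H_ring|].
rewrite same_side_intertwines by (try apply imag_unit_opp; assumption).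
unfold other_side, same_side; clear; H_ring.
Qed.

(** The difference of the two sides is left holomorphic and vanishes on the real
    axis. *)
Lemma representation_upper (r : R) (f : H -> H) (I J : H) (x y : R) :
  0 < r -> regular (Hball r) f -> imag_unit I -> imag_unit J ->
  0 <= y -> x ^ 2 + y ^ 2 < r ^ 2 ->
  f (slice x y I) =
  (same_side I J * f (slice x y J) + other_side I J * f (slice x y (- J)))%H.
Proof.
intros Hr Hf HI HJ Hy Hxy.
assert (HJ' := imag_unit_opp J HJ).
set (h := fun x y : R => (f (slice x y I) +
  (- same_side I J * f (slice x y J) + - other_side I J * f (slice x y (- J))))%H).
assert (Hz : h x y = 0%H).
{ apply (left_holomorphic_zero I h r); try assumption.
  - intros u v Huv. unfold h.
    apply left_holomorphic_plus; [apply (regular_slice r); assumption|].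
    apply left_holomorphic_plus.
    + apply (left_holomorphic_Hmult I J _ (fun x y => f (slice x y J))).
      * transitivity (- (same_side I J * J))%H; [clear; H_ring|].
        rewrite same_side_intertwines by assumption. clear; H_ring.
      * apply (regular_slice r); assumption.
    + apply (left_holomorphic_Hmult I (- J)%H _ (fun x y => f (slice x y (- J)%H))).
      * transitivity (- (other_side I J * - J))%H; [clear; H_ring|].
        rewrite other_side_intertwines by assumption. clear; H_ring.
      * apply (regular_slice r); assumption.
  - intros u Hu. unfold h.
    assert (Es : forall K, slice u 0 K = RtoH u) by (intro K; unfold slice; H_ring).
    rewrite !Es. unfold same_side, other_side. generalize (f (RtoH u)).
    clear; intro q; H_ring. }
transitivity (h x y +
  (same_side I J * f (slice x y J) + other_side I J * f (slice x y (- J))))%H.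
- unfold h. generalize (f (slice x y I)) (f (slice x y J)) (f (slice x y (- J)%H))
    (same_side I J) (other_side I J). clear; intros; H_ring.
- rewrite Hz. generalize (same_side I J * f (slice x y J) + other_side I J * f (slice x y (- J)))%H.
  clear; intros; H_ring.
Qed.

(** Changing the signs of y, I and J together changes neither the points nor the
    weights, so y >= 0 may be assumed. *)
Lemma representation_formula (r : R) (f : H -> H) (I J : H) (x y : R) :
  0 < r -> regular (Hball r) f -> imag_unit I -> imag_unit J ->
  x ^ 2 + y ^ 2 < r ^ 2 ->
  f (slice x y I) =
  (same_side I J * f (slice x y J) + other_side I J * f (slice x y (- J)))%H.
Proof.
intros Hr Hf HI HJ Hxy.
destruct (Rle_or_lt 0 y) as [Hy|Hy]; [apply (representation_upper r); assumption|].
rewrite <- (slice_opp I x y), <- (slice_opp J x y), <- (slice_opp (- J)%H x y).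
rewrite (representation_upper r f (- I)%H (- J)%H x (- y)) by
  (try apply imag_unit_opp; try assumption; try lra; nra).
assert (Es : same_side (- I)%H (- J)%H = same_side I J)
  by (unfold same_side; clear; H_ring).
assert (Eo : other_side (- I)%H (- J)%H = other_side I J)
  by (unfold other_side; clear; H_ring).
rewrite Es, Eo. reflexivity.
Qed.

Theorem theorem5p1 :
  forall (r : R) (f : H -> H),
    0 < r ->
    regular (Hball r) f ->
    forall x y : R,
      (forall q : H, sphere x y q -> Hball r q) ->
      exists b c : H,
        (forall I : H, imag_unit I -> f (slice x y I) = (b + I * c)%H) /\
        (c = 0%H <-> constant_on (sphere x y) f).
Proof.
intros r f Hr Hf x y Hsphere.
set (J := (0, 1, 0, 0) : H).
assert (HJ : imag_unit J) by (unfold imag_unit, J, Hone, RtoH; H_ring).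
assert (HJ' := imag_unit_opp J HJ).
assert (Hxy : x ^ 2 + y ^ 2 < r ^ 2).
{ apply (Hball_slice r x y J Hr HJ), Hsphere. exists J; split; [exact HJ|reflexivity]. }
set (p := f (slice x y J)). set (m := f (slice x y (- J)%H)).
set (b := (RtoH (1 / 2) * (p + m))%H). set (c := (RtoH (1 / 2) * (J * (m + - p)))%H).
assert (Hbc : forall I : H, imag_unit I -> f (slice x y I) = (b + I * c)%H).
{ intros I HI. rewrite (representation_formula r f I J x y Hr Hf HI HJ Hxy).
  fold p m. clearbody p m. unfold b, c, same_side, other_side, RtoH, Hone. clear; H_ring. }
exists b, c; split; [exact Hbc|split].
- intro Hc. exists b. intros q [I [HI ->]]. rewrite (Hbc I HI), Hc.
  clearbody b. clear; H_ring.
- intros [k Hk].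
  assert (E1 : (b + J * c)%H = k) by (rewrite <- (Hbc J HJ); apply Hk; exists J; auto).
  assert (E2 : (b + - J * c)%H = k) by (rewrite <- (Hbc _ HJ'); apply Hk; exists (- J)%H; auto).
  assert (Hpm : p = m).
  { unfold p, m. rewrite (Hbc J HJ), (Hbc _ HJ'), E1, E2. reflexivity. }
  unfold c. rewrite Hpm. clearbody m. unfold J, RtoH. clear; H_ring.
Qed.
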